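(* Let $\Omega\subset\mathbb{R}^N$ be a bounded open set with $C^3$-smooth boundary, and assume that $a<0$, $p\in(0,1)$ and $u_0\in C_0^+(\overline{\Omega})$. Let $u$ be the corresponding classical solution in $Q_\infty$ to $$u_t-\Delta u=a|\nabla u|^p \ \text{ in } (0,\infty)\times\Omega,\qquad u=0\ \text{ on } (0,\infty)\times\partial\Omega,\qquad u(0,\cdot)=u_0\ \text{ in }\Omega.$$ Then there exists $T^*>0$ such that $u(t,x)=0$ for each $(t,x)\in(T^*,\infty)\times\Omega$.
   Context: $C_0(\overline{\Omega})$ is the space of continuous functions on $\overline{\Omega}$ vanishing on $\partial\Omega$, and $C_0^+(\overline{\Omega})$ is its positive cone (the non-negative functions in it). For $T\in(0,\infty]$, $Q_T=(0,T)\times\Omega$, and $C^{1,2}(Q_T)$ is the space of functions in $C(Q_T)$ that are differentiable in $t$ and twice differentiable in $x$ with $u_t,u_{x_i},u_{x_ix_j}\in C(Q_T)$. A classical solution in $Q_T$ with initial datum $u_0\in C_0(\overline\Omega)$ is a function $u\in C([0,T)\times\overline{\Omega})\cap C^{1,2}(Q_T)$ with $u(0)=u_0$, satisfying the equation pointwise in $Q_T$ and vanishing on $(0,T)\times\partial\Omega$. It also satisfies $u(t)=e^{t\Delta}u_0+a\int_0^t e^{(t-s)\Delta}|\nabla u(s)|^p\,ds$ for $t\in[0,T)$, where $(e^{t\Delta})_{t\ge0}$ is the linear heat semigroup in $\Omega$ with homogeneous Dirichlet boundary conditions. It is known that for $p\in(0,2]$, $a\in\mathbb{R}\setminus\{0\}$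 and $u_0\in C_0(\overline{\Omega})$ there is a unique classical solution in $Q_\infty$. *)

(* Defs.v *)
From HB Require Import structures.
From mathcomp Require Import all_boot all_order all_algebra.
From mathcomp Require Import all_classical all_reals all_analysis.

Set Implicit Arguments.
Unset Strict Implicit.
Unset Printing Implicit Defensive.

Import Order.TTheory GRing.Theory Num.Theory.
Import numFieldNormedType.Exports.

Local Open Scope classical_set_scope.
Local Open Scope ring_scope.

Section VectorCalculus.
Context {R : realType} {n : nat}.
Implicit Types (f : 'rV[R]_n -> R) (x : 'rV[R]_n) (i : 'I_n).

Definition partial i f x : R := 'D_(delta_mx 0 i) f x.

Definition has_partial i f x : Prop := derivable f x (delta_mx 0 i).

Definition gradient f x : 'rV[R]_n := \row_i partial i f x.

Definition laplacian f x : R := \sum_i partial i (partial i f) x.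

(* The library norm on 'rV[R]_n is the sup norm. *)
Definition euclidean_norm (v : 'rV[R]_n) : R :=
  Num.sqrt (\sum_i v 0 i ^+ 2).

Fixpoint class_C (k : nat) f : Prop :=
  match k with
  | 0 => continuous f
  | k'.+1 => continuous f /\
      forall i, (forall x, has_partial i f x) /\ class_C k' (partial i f)
  end.

End VectorCalculus.

Definition boundary {T : topologicalType} (A : set T) : set T :=
  closure A `\` interior A.

(* Near each of its boundary points, Omega is, after relabelling (choice of i)
   and reorienting (choice of the sign b) the coordinate axes, the region lying
   strictly above the graph of a C^k function of the N - 1 other coordinates. *)
Definition boundary_class_C {R : realType} {N : nat} (k : nat)
    (Omega : set 'rV[R]_N) : Prop :=
  forall x0, boundary Omega x0 ->
    exists (i : 'I_N) (b : bool) (g : 'rV[R]_N.-1 -> R),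
      class_C k g /\
      \forall x \near x0, Omega x <-> g (col' i x) < (-1) ^+ b * x 0 i.

Section ViscousHamiltonJacobi.
Context {R : realType} {N : nat}.
Implicit Types (Omega : set 'rV[R]_N) (T : \bar R).

(* Elements of C_0 are represented by total functions whose values outside
   the closure of Omega are irrelevant; likewise for solutions below. *)
Definition C0 Omega (u0 : 'rV[R]_N -> R) : Prop :=
  {within closure Omega, continuous u0} /\
  forall x, boundary Omega x -> u0 x = 0.

Definition C0_pos Omega (u0 : 'rV[R]_N -> R) : Prop :=
  C0 Omega u0 /\ forall x, closure Omega x -> 0 <= u0 x.

Definition Q T Omega : set (R * 'rV[R]_N) :=
  [set z | 0 < z.1 /\ (z.1%:E < T)%E /\ Omega z.2].

Definition Q_bar T Omega : set (R * 'rV[R]_N) :=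
  [set z | 0 <= z.1 /\ (z.1%:E < T)%E /\ closure Omega z.2].

Definition partial_t (u : R -> 'rV[R]_N -> R) (t : R) (x : 'rV[R]_N) : R :=
  derive1 (u ^~ x) t.

Definition class_C12 T Omega (u : R -> 'rV[R]_N -> R) : Prop :=
  {within Q T Omega, continuous (fun z => u z.1 z.2)} /\
  ((forall t x, Q T Omega (t, x) -> derivable (u ^~ x) t 1) /\
   {within Q T Omega, continuous (fun z => partial_t u z.1 z.2)}) /\
  (forall i,
    (forall t x, Q T Omega (t, x) -> has_partial i (u t) x) /\
    {within Q T Omega, continuous (fun z => partial i (u z.1) z.2)}) /\
  (forall i j,
    (forall t x, Q T Omega (t, x) -> has_partial j (partial i (u t)) x) /\
    {within Q T Omega,
      continuous (fun z => partial j (partial i (u z.1)) z.2)}).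

Definition classical_solution (a p : R) T Omega (u0 : 'rV[R]_N -> R)
    (u : R -> 'rV[R]_N -> R) : Prop :=
  {within Q_bar T Omega, continuous (fun z => u z.1 z.2)} /\
  class_C12 T Omega u /\
  (forall x, closure Omega x -> u 0 x = u0 x) /\
  (forall t x, Q T Omega (t, x) ->
    partial_t u t x - laplacian (u t) x =
      a * euclidean_norm (gradient (u t) x) `^ p) /\
  (forall t x, 0 < t -> (t%:E < T)%E -> boundary Omega x -> u t x = 0).

End ViscousHamiltonJacobi.

(* Main.v *)
(* The solution lies between 0 and the travelling wave
     w(t, x) = C max(x_i + b - c t, 0)^k,
   whose support leaves the bounded set Omega in finite time.  Choosing k with
   (k - 1) p <= k - 2 makes |w'|^p dominate w'' near the edge of the support,
   which is possible exactly because p < 1, and the amplitude C is then tuned so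
   that w is a supersolution above u_0.  The comparison does not suffer from
   r |-> r^p not being Lipschitz at 0: at a maximum point of u - w - eps t the
   gradients of u and w coincide, so the nonlinear terms cancel. *)
Require Import Defs.
From mathcomp Require Import all_boot all_order all_algebra.
From mathcomp Require Import all_classical all_reals all_analysis.
From mathcomp Require Import ring lra.
Import Order.TTheory GRing.Theory Num.Theory.
Import numFieldNormedType.Exports.
Local Open Scope classical_set_scope.
Local Open Scope ring_scope.

(** * Calculus at a maximum point *)

(** If [d < 0], the Carathéodory slope stays negative near [c], so [f] exceeds [f c] just to the
    left. The one-sided form serves the time variable, where a maximum is only known against earlier
    times. *)
Lemma derive_ge0_left_max {R : realType} {f : R -> R} {c d : R} :
  is_derive c 1 f d -> (\forall x \near c, x < c -> f x <= f c) -> 0 <= d.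
Proof.
move=> /is_derive1_caratheodory[g [fg cg gc]] fmax.
rewrite leNgt; apply/negP => d_lt0.
have g_lt0 : \forall x \near c, g x < 0.
  by apply: (cvgr_lt _ cg); rewrite gc.
have /nbhs_ballP[e /= e0 ce] :
    \forall x \near c, (x < c -> f x <= f c) /\ g x < 0.
  by near=> x; split; near: x.
have x_near : ball c e (c - e / 2).
  by rewrite /ball/= opprB addrCA subrr addr0 ger0_norm; lra.
have [/(_ ltac:(lra)) + gx] := ce _ x_near.
rewrite -subr_le0 fg => h.
have : 0 < g (c - e / 2) * (c - e / 2 - c) by rewrite nmulr_rgt0 //; lra.
by rewrite ltNge h.
Unshelve. all: by end_near.
Qed.

Lemma derive_le0_right_max {R : realType} {f : R -> R} {c d : R} :
  is_derive c 1 f d -> (\forall x \near c, c < x -> f x <= f c) -> d <= 0.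
Proof.
move=> /is_derive1_caratheodory[g [fg cg gc]] fmax.
rewrite leNgt; apply/negP => d_gt0.
have g_gt0 : \forall x \near c, 0 < g x.
  by apply: (cvgr_gt _ cg); rewrite gc.
have /nbhs_ballP[e /= e0 ce] :
    \forall x \near c, (c < x -> f x <= f c) /\ 0 < g x.
  by near=> x; split; near: x.
have x_near : ball c e (c + e / 2).
  by rewrite /ball/= opprD addrA subrr add0r normrN ger0_norm; lra.
have [/(_ ltac:(lra)) + gx] := ce _ x_near.
rewrite -subr_le0 fg => h.
have : 0 < g (c + e / 2) * (c + e / 2 - c) by rewrite mulr_gt0 //; lra.
by rewrite ltNge h.
Unshelve. all: by end_near.
Qed.

(** If [d2 > 0], then [df], which vanishes at [c], is positive just to the right of it, and the mean
    value theorem makes [f] exceed [f c] there. *)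
Lemma second_derivative_test {R : realType} {f df : R -> R} {c d2 : R} :
  (\forall x \near c, is_derive x (1 : R) f (df x)) -> is_derive c 1 df d2 ->
  (\forall x \near c, f x <= f c) -> df c = 0 /\ d2 <= 0.
Proof.
move=> fdf ddf fmax.
have df0 : df c = 0.
  have dfc := nbhs_singleton fdf.
  apply/eqP; rewrite eq_le; apply/andP; split.
    by apply: derive_le0_right_max dfc _; near=> x => _; near: x.
  by apply: derive_ge0_left_max dfc _; near=> x => _; near: x.
split=> //; rewrite leNgt; apply/negP => d2_gt0.
have /is_derive1_caratheodory[g [dfg cg gc]] := ddf.
have g_gt0 : \forall x \near c, 0 < g x.
  by apply: (cvgr_gt _ cg); rewrite gc.
have /nbhs_ballP[e /= e0 ce] :
    \forall x \near c, [/\ is_derive x (1 : R) f (df x), f x <= f c & 0 < g x].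
  by near=> x; split; near: x.
have in_ball x : c <= x <= c + e / 2 -> ball c e x.
  by move=> /andP[cx xc]; rewrite /ball/= ler0_norm; lra.
have c_lt : c < c + e / 2 by lra.
have [x|x|x /[!in_itv]/= /andP[cx xc] fE] := @MVT _ f df _ _ c_lt.
- by rewrite in_itv/= => /andP[cx xc]; have [] := ce x (in_ball x ltac:(lra)).
- apply: derivable_within_continuous => y; rewrite in_itv/= => /andP[cy yc].
  by have [[]] := ce y (in_ball y ltac:(lra)).
have [_ _ gx] := ce x (in_ball x ltac:(lra)).
have [_ fle _] := ce (c + e / 2) (in_ball (c + e / 2) ltac:(lra)).
have dfx : 0 < df x.
  by have := dfg x; rewrite df0 subr0 => ->; rewrite mulr_gt0 // subr_gt0.
by move: fE; have := mulr_gt0 dfx (_ : 0 < c + e / 2 - c); lra.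
Unshelve. all: by end_near.
Qed.

Lemma is_derive_line {R : realType} {n : nat} {f : 'rV[R]_n -> R}
    {x v : 'rV[R]_n} {s : R} :
  derivable f (s *: v + x) v ->
  is_derive s 1 (fun h : R => f (h *: v + x)) ('D_v f (s *: v + x)).
Proof.
have E : (fun h : R => h^-1 *: (f (h *: v + (s *: v + x)) - f (s *: v + x))) =
    (fun h : R => h^-1 *: (f ((h *: (1 : R) + s) *: v + x) - f (s *: v + x))).
  apply/funext => h; have -> : h *: (1 : R) = h by exact: mulr1.
  by rewrite scalerDl addrA.
rewrite /derivable /derive /= => fd.
by apply: DeriveDef; rewrite /derivable /derive /= -?E.
Qed.

(** The second derivative test along the [i]-th axis through [x0], with [psi] the restriction of a
    test function to that axis. The factor [s] allows both signs: -1 for the lower bound on the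
    solution, 1 for the upper. *)
Lemma partial_at_max {R : realType} {n : nat} {Omega : set 'rV[R]_n}
    {v : 'rV[R]_n -> R} {x0 : 'rV[R]_n} {i : 'I_n} (s : R)
    {psi dpsi : R -> R} {d2psi : R} :
  open Omega -> Omega x0 ->
  (forall x, Omega x -> has_partial i v x) ->
  has_partial i (partial i v) x0 ->
  (forall h : R, is_derive h 1 psi (dpsi h)) -> is_derive (0 : R) 1 dpsi d2psi ->
  (forall h : R, Omega (h *: delta_mx 0 i + x0) ->
    s * v (h *: delta_mx 0 i + x0) - psi h <= s * v x0 - psi 0) ->
  s * partial i v x0 = dpsi 0 /\ s * partial i (partial i v) x0 <= d2psi.
Proof.
move=> Oo Ox0 dv ddv dpsiE ddpsi vmax.
pose e : 'rV[R]_n := delta_mx 0 i.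
have near_O : \forall h \near (0 : R), Omega (h *: e + x0).
  have : (fun h : R => h *: e + x0) @ (0 : R) --> 0 *: e + x0.
    by apply: cvgD; [apply: cvgZl; exact: cvg_id|exact: cvg_cst].
  apply; rewrite scale0r add0r; exact: open_nbhs_nbhs.
have := @second_derivative_test R
  (fun h : R => s * v (h *: e + x0) - psi h)
  (fun h : R => s * partial i v (h *: e + x0) - dpsi h) 0
  (s * partial i (partial i v) x0 - d2psi).
rewrite scale0r add0r => -[|||].
- near=> h; have dvh : has_partial i v (h *: e + x0) by apply: dv; near: h.
  have dvh' := is_derive_line dvh.
  have := is_deriveB (is_deriveZ s dvh') (dpsiE h).
  exact.
- have ddv0 : derivable (partial i v) (0 *: e + x0) e by rewrite scale0r add0r.
  have := is_derive_line ddv0; rewrite scale0r add0r => ddv'.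
  exact: is_deriveB (is_deriveZ s ddv') ddpsi.
- by near=> h; apply: vmax; near: h.
by move=> /subr0_eq -> /[!subr_le0].
Unshelve. all: by end_near.
Qed.

(** * Maximum points in space-time *)

Lemma bounded_closure {R : realType} {V : normedModType R} {A : set V} :
  bounded_set A -> bounded_set (closure A).
Proof.
move=> [M [Mreal AM]]; exists M; split=> // B MB x.
have cB : closed [set y : V | `|y| <= B].
  apply: (@closed_comp _ _ (fun y : V => `|y|) [set y : R | y <= B]).
    by move=> y _; exact: norm_continuous.
  exact: closed_le.
have /(closure_subset) : A `<=` [set y : V | `|y| <= B] by move=> y /(AM _ MB).
by rewrite -(proj1 (closure_id _) cB); exact.
Qed.

(** The maximum over the compact set [[0, t1] x closure Omega] is positive, hence attained neither
    at time 0 nor on the boundary. The penalty [eps * t] forces the time derivative of [v] to be at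
    least [eps] there, which comparison arguments contradict. *)
Lemma positive_max_interior {R : realType} {n : nat} {Omega : set 'rV[R]_n}
    {v : R -> 'rV[R]_n -> R} {t1 : R} {x1 : 'rV[R]_n} :
  open Omega -> bounded_set Omega ->
  {within Q_bar +oo%E Omega, continuous (fun z => v z.1 z.2)} ->
  (forall x, closure Omega x -> v 0 x <= 0) ->
  (forall t x, 0 < t -> boundary Omega x -> v t x <= 0) ->
  0 < t1 -> Omega x1 -> 0 < v t1 x1 ->
  exists eps t0 x0, [/\ 0 < eps, 0 < t0, Omega x0 &
    forall t x, 0 <= t <= t0 -> Omega x ->
      v t x - eps * t <= v t0 x0 - eps * t0].
Proof.
move=> Oo Ob vc v_init v_bd t1_gt0 Ox1 v1_gt0.
have Ox1' : closure Omega x1 by exact: subset_closure.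
pose K := `[0, t1] `*` closure Omega.
have Kcompact : compact K.
  apply: compact_setX; first exact: segment_compact.
  apply: bounded_closed_compact; last exact: closed_closure.
  exact: bounded_closure.
(* Small enough that half of [v t1 x1] survives the penalty at time [t1]. *)
pose eps := v t1 x1 / (2 * t1).
have eps_gt0 : 0 < eps by rewrite divr_gt0 // mulr_gt0.
have Kc :
    {within K, continuous (fun z : R * 'rV[R]_n => v z.1 z.2 - eps * z.1)}.
  apply: within_continuousB.
    apply: continuous_subspaceW vc => -[t x] [/=].
    rewrite in_itv/= => /andP[t0 _] xO; split=> //; split=> //; exact: ltry.
  apply: continuous_subspaceT => z; apply: cvgM; [exact: cvg_cst|exact: cvg_fst].
have K0 : K !=set0 by exists (t1, x1); split=> //=; rewrite in_itv/= lexx ltW.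
have [[t0 x0] /set_mem[/= + x0O] vmax] := compact_EVT_max K0 Kcompact Kc.
rewrite in_itv/= => /andP[t0_ge0 t0_le].
have max_gt0 : 0 < v t0 x0 - eps * t0.
  have /= : (t1, x1) \in K.
    by apply/mem_set; split=> //=; rewrite in_itv/= lexx ltW.
  move=> /vmax/=; apply: lt_le_trans.
  by have -> : eps * t1 = v t1 x1 / 2; [rewrite /eps; field; lra|lra].
have v_gt0 : 0 < v t0 x0 by have := mulr_ge0 (ltW eps_gt0) t0_ge0; lra.
have t0_gt0 : 0 < t0.
  rewrite lt_neqAle t0_ge0 andbT; apply/eqP => t00.
  by move: v_gt0; rewrite -t00 ltNge v_init.
exists eps, t0, x0; split=> //.
  have [//|nO] := pselect (Omega x0).
  suff : v t0 x0 <= 0 by rewrite leNgt v_gt0.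
  by apply: v_bd => //; split=> //; rewrite (proj1 (interior_id _)).
move=> t x /andP[t_ge0 t_le] Ox; apply: (vmax (t, x)); apply/mem_set.
split=> /=; last exact: subset_closure.
by rewrite in_itv/= t_ge0 (le_trans t_le).
Qed.

(** * Lower bound: comparison with zero *)

(** At a positive maximum of [- u - eps * t] the gradient vanishes and the Laplacian of [u] is
    nonnegative, so the equation gives a nonnegative time derivative, whereas maximality makes it at
    most [- eps]. *)
Lemma solution_ge0 {R : realType} {N : nat} {Omega : set 'rV[R]_N} {a p : R}
    {u0 : 'rV[R]_N -> R} {u : R -> 'rV[R]_N -> R} :
  open Omega -> bounded_set Omega -> p != 0 -> C0_pos Omega u0 ->
  classical_solution a p +oo%E Omega u0 u ->
  forall t x, 0 < t -> Omega x -> 0 <= u t x.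
Proof.
move=> Oo Ob p_neq0 [_ u0_ge0] [uc [[_ [[ut _] [ux uxx]]] [u_init [pde u_bd]]]].
move=> t x t_gt0 Ox; rewrite leNgt; apply/negP => u_lt0.
have inQ s y : 0 < s -> Omega y -> Q +oo%E Omega (s, y).
  by move=> s_gt0 Oy; split=> //; split=> //; exact: ltry.
have [|y yO|s y s_gt0 yO||||eps [t0 [x0 [eps_gt0 t0_gt0 Ox0 vmax]]]] :=
  @positive_max_interior R N Omega (fun t x => - 1 * u t x) t x Oo Ob.
- by move=> z; apply: cvgM; [exact: cvg_cst|exact: uc].
- by rewrite mulN1r oppr_le0 u_init // u0_ge0.
- by rewrite mulN1r u_bd ?oppr0 //; exact: ltry.
- exact: t_gt0.
- exact: Ox.
- by rewrite mulN1r oppr_gt0.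
have cst_derive (h : R) : is_derive h (1 : R) (cst (0 : R)) (cst (0 : R) h).
  exact: is_derive_cst.
have space i :=
  @partial_at_max R N Omega (u t0) x0 i (-1) (cst 0) (cst 0) 0 Oo Ox0
  (fun x Ox => (ux i).1 t0 x (inQ _ _ t0_gt0 Ox))
  ((uxx i i).1 t0 x0 (inQ _ _ t0_gt0 Ox0))
  cst_derive (cst_derive 0).
have {}space i :
    partial i (u t0) x0 = 0 /\ 0 <= partial i (partial i (u t0)) x0.
  have [h Oh|] := space i.
  - have := vmax t0 _ _ Oh; rewrite lexx ltW //= => /(_ isT); lra.
  - by rewrite /= => ? ?; split; lra.
have grad0 : euclidean_norm (gradient (u t0) x0) = 0.
  rewrite /euclidean_norm big1 ?sqrtr0 // => i _.
  by rewrite mxE (space i).1 expr0n.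
have lap_ge0 : 0 <= laplacian (u t0) x0.
  by apply: sumr_ge0 => i _; exact: (space i).2.
have := pde _ _ (inQ _ _ t0_gt0 Ox0).
(* Here [p != 0] matters, since [powR] gives 0 to the power 0 the value 1. *)
rewrite grad0 powR0 // mulr0 => /eqP; rewrite subr_eq0 => /eqP ut_lap.
have dut : is_derive t0 (1 : R) (u ^~ x0) (partial_t u t0 x0).
  rewrite /partial_t derive1E; apply: derivableP; exact: ut (inQ _ _ t0_gt0 Ox0).
have dv := is_deriveB (is_deriveZ (-1) dut) (is_deriveZ eps (is_derive_id t0 1)).
suff : 0 <= - 1 * partial_t u t0 x0 - eps * 1 by rewrite ut_lap; lra.
apply: derive_ge0_left_max dv _.
near=> s => s_lt; apply: vmax => //; rewrite (ltW s_lt) andbT.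
by apply/ltW; near: s; exact: lt_nbhsr.
Unshelve. all: by end_near.
Qed.

(** * Upper bound: comparison with the travelling wave *)

Lemma is_derive_affineX {R : realType} (C b d h : R) (k : nat) :
  is_derive h (1 : R) (fun h => C * (b + h * d) ^+ k)
    (C * (k%:R * d) * (b + h * d) ^+ k.-1).
Proof.
have daff : is_derive h (1 : R) (cst b + d *: id) d.
  have := is_deriveD (is_derive_cst b h (1 : R))
    (is_deriveZ d (is_derive_id h (1 : R))).
  by move/is_derive_eq; apply; rewrite add0r; exact: mulr1.
have -> : (fun h => C * (b + h * d) ^+ k) = C *: (cst b + d *: id) ^+ k.
  by rewrite exprfctE; apply/funext => s; rewrite [s * d]mulrC.
have := is_deriveZ C (is_deriveX k daff).
move/is_derive_eq; apply; rewrite /GRing.scale/= !fctE/= /GRing.scale/=.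
by rewrite [d * h]mulrC; ring.
Qed.

(** The last hypothesis is the supersolution inequality for [C * y ^+ k] in the wave variable
    [y = x_i0 + b - c * t]; on [Omega] this variable never exceeds [L]. *)
Lemma solution_le_barrier {R : realType} {N : nat} {Omega : set 'rV[R]_N}
    {a p : R} {u0 : 'rV[R]_N -> R} {u : R -> 'rV[R]_N -> R} {i0 : 'I_N}
    {C b c L : R} {k : nat} :
  open Omega -> bounded_set Omega ->
  classical_solution a p +oo%E Omega u0 u ->
  0 <= C -> 0 <= c -> ~~ odd k -> (2 < k)%N ->
  (forall x, closure Omega x -> u0 x <= C * Num.max (x 0 i0 + b) 0 ^+ k) ->
  (forall x, Omega x -> x 0 i0 + b <= L) ->
  0 <= L ->
  (forall y, 0 <= y <= L ->
    C * k%:R * c * y ^+ k.-1 + C * k%:R * k.-1%:R * y ^+ k.-2 <=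
      - a * (C * k%:R * y ^+ k.-1) `^ p) ->
  forall t x, 0 < t -> Omega x ->
    u t x <= C * Num.max (x 0 i0 + b - c * t) 0 ^+ k.
Proof.
move=> Oo Ob [uc [[_ [[ut _] [ux uxx]]] [u_init [pde u_bd]]]].
move=> C_ge0 c_ge0 k_even k_gt2 u0_le xL L_ge0 super t x t_gt0 Ox.
rewrite leNgt -subr_gt0; apply/negP => u_gt.
have inQ s y : 0 < s -> Omega y -> Q +oo%E Omega (s, y).
  by move=> s_gt0 Oy; split=> //; split=> //; exact: ltry.
pose w s (y : 'rV[R]_N) := C * Num.max (y 0 i0 + b - c * s) 0 ^+ k.
have w_ge0 s y : 0 <= w s y by rewrite mulr_ge0 // exprn_even_ge0.
have wc : continuous (fun z : R * 'rV[R]_N => w z.1 z.2).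
  move=> z; apply: cvgM; first exact: cvg_cst.
  pose y (z : R * 'rV[R]_N) := z.2 0 i0 + b - c * z.1.
  apply: (@continuous_comp _ _ _ (fun z => Num.max (y z) 0)
    (fun r : R => r ^+ k)); last exact: exprn_continuous.
  apply: (@continuous_max _ _ y (cst 0)); last exact: cvg_cst.
  apply: cvgB.
    apply: cvgD; last exact: cvg_cst.
    apply: (@continuous_comp _ _ _ (@snd R 'rV[R]_N) (fun y => y 0 i0)).
      exact: cvg_snd.
    exact: coord_continuous.
  by apply: cvgM; [exact: cvg_cst|exact: cvg_fst].
have [|y yO|s y s_gt0 yO||||eps [t0 [x0 [eps_gt0 t0_gt0 Ox0 vmax]]]] :=
  @positive_max_interior R N Omega (fun t x => u t x - w t x) t x Oo Ob.
- by apply: within_continuousB => //; exact: continuous_subspaceT.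
- by rewrite /w mulr0 subr0 u_init // subr_le0 u0_le.
- by rewrite u_bd ?sub0r ?oppr_le0 //; exact: ltry.
- exact: t_gt0.
- exact: Ox.
- exact: u_gt.
pose y0 := x0 0 i0 + b - c * t0.
pose y1 := Num.max y0 0.
have y1E : y0 - Num.min y0 0 = y1.
  by have := addr_max_min y0 0; rewrite addr0 /y1; lra.
have w0E : w t0 x0 = C * y1 ^+ k by [].
(* As k is even, this polynomial lies above w and touches it at (t0, x0), so it
   can replace w at the maximum point, where w need not be differentiated. *)
have w_le s (y : 'rV[R]_N) :
    w s y <= C * (y 0 i0 + b - c * s - Num.min y0 0) ^+ k.
  rewrite /w ler_wpM2l //.
  have [y_le0|y_gt0] := lerP (y 0 i0 + b - c * s) 0.
    by rewrite expr0n; case: (k) k_gt2 k_even => // k' _ ?; exact: exprn_even_ge0.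
  by rewrite lerXn2r ?nnegrE; have := ge_min 0 y0 0; rewrite lexx orbT; lra.
have y1_ge0 : 0 <= y1 by rewrite le_max lexx orbT.
have y1_le : y1 <= L.
  rewrite ge_max L_ge0 andbT /y0; have := xL _ Ox0.
  by have := mulr_ge0 c_ge0 (ltW t0_gt0); lra.
(* Slope of the wave variable along the [i]-th axis. *)
pose d (i : 'I_N) : R := (i == i0)%:R.
have space i : partial i (u t0) x0 = C * (k%:R * d i) * y1 ^+ k.-1 /\
    partial i (partial i (u t0)) x0 <=
      C * (k%:R * d i) * (k.-1%:R * d i) * y1 ^+ k.-2.
  have := @partial_at_max R N Omega (u t0) x0 i 1 _ _ _ Oo Ox0
    (fun x Ox => (ux i).1 t0 x (inQ _ _ t0_gt0 Ox))
    ((uxx i i).1 t0 x0 (inQ _ _ t0_gt0 Ox0))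
    (fun h => is_derive_affineX C y1 (d i) h k)
    (is_derive_affineX (C * (k%:R * d i)) y1 (d i) 0 k.-1).
  rewrite !mul0r !addr0 !mul1r; apply => h Oh.
  have := vmax t0 _ _ Oh; rewrite lexx ltW //= => /(_ isT).
  have := w_le t0 (h *: delta_mx 0 i + x0).
  rewrite w0E !mxE eqxx/= mul1r => wh.
  have -> : y1 + h * d i =
      h * (i0 == i)%:R + x0 0 i0 + b - c * t0 - Num.min y0 0.
    by rewrite -y1E /d /y0 eq_sym; ring.
  by lra.
have grad : euclidean_norm (gradient (u t0) x0) = C * k%:R * y1 ^+ k.-1.
  rewrite /euclidean_norm (bigD1 i0) //= big1 ?addr0 => [|i /negPf i_neq].
    rewrite mxE (space i0).1 /d eqxx mulr1 sqrtr_sqr ger0_norm //.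
    by rewrite !mulr_ge0 // exprn_ge0.
  by rewrite mxE (space i).1 /d i_neq !(mulr0, mul0r) expr0n.
have lap_le : laplacian (u t0) x0 <= C * k%:R * k.-1%:R * y1 ^+ k.-2.
  rewrite /laplacian (bigD1 i0) //= -[leRHS]addr0 lerD //.
    by have := (space i0).2; rewrite /d eqxx !mulr1.
  apply: sumr_le0 => i /negPf i_neq.
  by have := (space i).2; rewrite /d i_neq !(mulr0, mul0r).
have := pde _ _ (inQ _ _ t0_gt0 Ox0); rewrite grad => eqn.
have dut : is_derive t0 (1 : R) (u ^~ x0) (partial_t u t0 x0).
  rewrite /partial_t derive1E; apply: derivableP; exact: ut (inQ _ _ t0_gt0 Ox0).
have dw := is_derive_affineX C (x0 0 i0 + b - Num.min y0 0) (- c) t0 k.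
have dv :=
  is_deriveB (is_deriveB dut dw) (is_deriveZ eps (is_derive_id t0 (1 : R))).
(* The equation, [lap_le] and [super] at [y1] bound this expression above by [- eps]. *)
suff : 0 <= partial_t u t0 x0 - C * (k%:R * - c) * y1 ^+ k.-1 - eps * 1.
  have := super y1; rewrite y1_ge0 y1_le => /(_ isT); lra.
rewrite -y1E (_ : y0 - _ = x0 0 i0 + b - Num.min y0 0 + t0 * - c); last first.
  by rewrite /y0; ring.
apply: derive_ge0_left_max dv _.
near=> s => s_lt; rewrite !fctE/= /GRing.scale/=.
have baseE r : x0 0 i0 + b - Num.min y0 0 + r * - c =
    x0 0 i0 + b - c * r - Num.min y0 0 by ring.
rewrite !baseE -/y0 y1E -w0E.
have s_ge0 : 0 <= s by apply/ltW; near: s; exact: lt_nbhsr.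
have := vmax s x0 _ Ox0; rewrite s_ge0 (ltW s_lt) => /(_ isT).
by have := w_le s x0; lra.
Unshelve. all: by end_near.
Qed.

(** * Choice of the constants of the barrier *)

(** With [z = y / L] and [D = B * k / L], both at most 1, the left side is at most
    [k / L * D * z ^+ n] and the right side at least [A * D * z ^+ n], so a large [L] suffices. *)
Lemma barrier_parameters {R : realType} {A p M r : R} :
  0 < A -> 0 < p -> p < 1 -> 0 <= M -> 0 <= r ->
  exists k (C c L : R), [/\ ~~ odd k, (2 < k)%N, 0 <= C & 0 < c] /\
    [/\ 4 * r <= L, M <= C * (L / 2) ^+ k &
    forall y, 0 <= y <= L ->
      C * k%:R * c * y ^+ k.-1 + C * k%:R * k.-1%:R * y ^+ k.-2 <=
        A * (C * k%:R * y ^+ k.-1) `^ p].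
Proof.
move=> A_gt0 p_gt0 p_lt1 M_ge0 r_ge0.
(* Doubling makes [k] even, and half of [n] exceeds [1 / (1 - p)], which yields
   [(n + 1) * p <= n]. *)
pose n := (Num.truncn (1 - p)^-1).+1.*2; pose k := n.+2.
have k_even : ~~ odd k by rewrite /= negbK odd_double.
have n_gt0 : (0 < n)%N by [].
have n_ge : n.+1%:R * p <= n%:R.
  have := truncnS_gt (1 - p)^-1; set m := _.+1 => m_gt.
  have : 1 < m%:R * (1 - p).
    by rewrite -ltr_pdivrMr ?div1r // subr_gt0.
  have -> : n = (m + m)%N by rewrite addnn.
  rewrite -natr1 natrD; set q := m%:R.
  have : 0 <= q by exact: ler0n.
  by move: p_lt1; nra.
(* Chosen so that [C = B / L ^+ k] gives [C * (L / 2) ^+ k = M + 1]. *)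
pose B := (M + 1) * 2 ^+ k.
have B_gt0 : 0 < B by rewrite mulr_gt0 ?exprn_gt0 //; lra.
have Bk_gt0 : 0 < B * k%:R by rewrite mulr_gt0 // ltr0n.
have kA_gt0 : 0 < k%:R / A by rewrite divr_gt0 // ltr0n.
(* The three terms ensure [4 * r <= L], [D <= 1] and [k / L <= A] respectively. *)
pose L := 4 * r + B * k%:R + k%:R / A.
have L_gt0 : 0 < L by rewrite /L; lra.
have L_neq0 : L != 0 by rewrite gt_eqF.
exists k, (B / L ^+ k), L^-1, L; split; split=> //.
- by rewrite divr_ge0 ?exprn_ge0 // ltW.
- by rewrite invr_gt0.
- by rewrite /L; lra.
- rewrite expr_div_n -mulrA [_^-1 * _]mulrA mulVf ?expf_neq0 // mul1r /B.
  by rewrite mulfK ?expf_neq0 ?pnatr_eq0 //; lra.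
move=> y /andP[y_ge0 y_le]; rewrite -[k.-1]/n.+1 -[k.-2]/n.
pose D := B * k%:R / L.
have D_gt0 : 0 < D by rewrite divr_gt0.
have D_le1 : D <= 1 by rewrite ler_pdivrMr // mul1r /L; lra.
have [y0|y_gt0] := leP y 0.
  have -> : y = 0 by lra.
  rewrite !expr0n /= !mulr0 addr0.
  by rewrite mulr_ge0 ?powR_ge0 // ltW.
pose z := y / L.
have z_gt0 : 0 < z by rewrite divr_gt0.
have z_le1 : z <= 1 by rewrite ler_pdivrMr // mul1r.
have yE : y = z * L by rewrite divfK.
have slopeE : B / L ^+ k * k%:R * y ^+ n.+1 = D * z ^+ n.+1.
  rewrite yE exprMn /D /k [L ^+ n.+2]exprS.
  by field; rewrite L_neq0 expf_neq0.
have curvE : B / L ^+ k * k%:R * n.+1%:R * y ^+ n = D / L * n.+1%:R * z ^+ n.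
  rewrite yE exprMn /D /k [L ^+ n.+2]exprS [L ^+ n.+1]exprS.
  by field; rewrite L_neq0 expf_neq0.
rewrite mulrAC slopeE curvE powRM ?exprn_ge0 ?(ltW z_gt0) ?(ltW D_gt0) //.
have D_le : D <= D `^ p by apply: ger1_powR; rewrite ?D_gt0 // ltW.
(* As [z <= 1], the smaller exponent [(n + 1) * p] gives the larger power. *)
have z_le : z ^+ n <= (z ^+ n.+1) `^ p.
  rewrite -!powR_mulrn ?(ltW z_gt0) // -powRrM.
  by apply: ger_powR => //; rewrite z_gt0.
have zn_gt0 : 0 < z ^+ n by exact: exprn_gt0.
have zS_le : z ^+ n.+1 <= z ^+ n.
  by rewrite exprS ger_pMl.
apply: (@le_trans _ _ (A * (D * z ^+ n))); last first.
  by rewrite ler_pM2l // ler_pM // ltW.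
have kL_le : k%:R / L <= A.
  by rewrite ler_pdivrMr // -ler_pdivrMl // mulrC /L; lra.
apply: (@le_trans _ _ (k%:R / L * (D * z ^+ n))); last first.
  by rewrite ler_pM2r // mulr_gt0.
(* Splitting [k = 1 + (n + 1)] leaves only the comparison of the drift term with
   [D / L * z ^+ n]. *)
rewrite (_ : k%:R / L * (D * z ^+ n) =
  D / L * z ^+ n + D / L * n.+1%:R * z ^+ n); last first.
  by rewrite /k -[n.+2%:R]natr1; ring.
by rewrite lerD2r mulrAC ler_pM2l // divr_gt0.
Qed.

(** * Extinction in finite time *)

Theorem theorem1p1 (R : realType) (N : nat) (Omega : set 'rV[R]_N)
    (a p : R) (u0 : 'rV[R]_N -> R) (u : R -> 'rV[R]_N -> R)
    (N_gt0 : (0 < N)%N)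
    (Omega_open : open Omega) (Omega_bounded : bounded_set Omega)
    (Omega_C3 : boundary_class_C 3 Omega)
    (a_lt0 : a < 0) (p_gt0 : 0 < p) (p_lt1 : p < 1)
    (u0_C0_pos : C0_pos Omega u0)
    (u_sol : classical_solution a p +oo%E Omega u0 u) :
  exists2 Tstar : R, 0 < Tstar &
    forall t x, Tstar < t -> Omega x -> u t x = 0.
Proof.
(* A point of [Omega] is needed below for [u0] to attain its maximum on the closure. *)
have [->|/set0P[xO OxO]] := eqVneq Omega set0; first by exists 1.
pose i0 := Ordinal N_gt0.
have clb := bounded_closure Omega_bounded.
have clc : compact (closure Omega).
  by apply: bounded_closed_compact => //; exact: closed_closure.
have [r r_ge0 x_le] : exists2 r : R, 0 <= r &
    forall x, closure Omega x -> `|x 0 i0| <= r.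
  have [r [_ rP]] := clb.
  exists (Num.max r 0 + 1); first by rewrite addr_ge0 // le_max lexx orbT.
  move=> x Ox; have /rP/(_ x Ox) : r < Num.max r 0 + 1.
    by rewrite (@le_lt_trans _ _ (Num.max r 0)) ?ltrDl // le_max lexx.
  apply: le_trans; rewrite [leRHS]/Num.norm/= mx_normrE.
  by apply/bigmax_geP; right; exists (0, i0).
have [M M_ge0 u0_le] : exists2 M : R, 0 <= M &
    forall x, closure Omega x -> u0 x <= M.
  have cl0 : closure Omega !=set0 by exists xO; exact: subset_closure.
  have [xM /set_mem xMO xMP] := compact_EVT_max cl0 clc u0_C0_pos.1.1.
  exists (u0 xM); first exact: u0_C0_pos.2.
  by move=> x /mem_set/xMP.
have A_gt0 : 0 < - a by rewrite oppr_gt0.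
have [k [C [c [L [[k_even k_gt2 C_ge0 c_gt0] [rL ML super]]]]]] :=
  barrier_parameters A_gt0 p_gt0 p_lt1 M_ge0 r_ge0.
have L_ge0 : 0 <= L by lra.
(* After time [L / c] the wave variable is negative on all of [Omega]; the added 1 makes the bound
   positive. *)
exists (L / c + 1); first by rewrite ltr_pwDr // divr_ge0 // ltW.
move=> t x t_gt Ox.
have Lc_ge0 : 0 <= L / c by rewrite divr_ge0 // ltW.
have t_gt0 : 0 < t by lra.
have Ox' : closure Omega x by exact: subset_closure.
apply/eqP; rewrite eq_le; apply/andP; split; last first.
  by apply: (solution_ge0 _ _ _ u0_C0_pos u_sol) => //; rewrite gt_eqF.
(* The shift [L - r] puts the initial wave variable in [[L - 2 * r, L]], hence above [L / 2], where
   the barrier is at least [M]. *)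
have u0_le_barrier y : closure Omega y ->
    u0 y <= C * Num.max (y 0 i0 + (L - r)) 0 ^+ k.
  move=> Oy; apply: (le_trans (u0_le y Oy)); apply: (le_trans ML).
  rewrite ler_wpM2l // lerXn2r ?nnegrE ?le_max ?lexx ?orbT //; first lra.
  by have := x_le y Oy; rewrite ler_norml => /andP[? _]; apply/orP; left; lra.
have x_leL y : Omega y -> y 0 i0 + (L - r) <= L.
  by move=> /subset_closure/x_le; rewrite ler_norml => /andP[_ ?]; lra.
have := solution_le_barrier Omega_open Omega_bounded u_sol C_ge0 (ltW c_gt0)
  k_even k_gt2 u0_le_barrier x_leL L_ge0 super t x t_gt0 Ox.
have -> : Num.max (x 0 i0 + (L - r) - c * t) 0 = 0.
  apply/max_idPr; have := x_leL x Ox.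
  have : L / c < t by lra.
  by rewrite ltr_pdivrMr // mulrC; lra.
by rewrite expr0n; case: (k) k_gt2 => //= k' _; rewrite mulr0.
Qed.
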